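(* If $\phi: M_3(\mathbb{C}) \to M_3(\mathbb{C})$ is a unital $q$-positive map and $\phi(R)=0$ for some nonzero positive matrix $R \in M_3(\mathbb{C})$, then $\phi$ is not $q$-pure.
   Context: A positive matrix is a self-adjoint matrix whose eigenvalues are all nonnegative. A linear map $\phi: M_n(\mathbb{C}) \to M_n(\mathbb{C})$ is $q$-positive if $\phi$ has no negative eigenvalues and $\phi(I+t\phi)^{-1}$ is completely positive for all $t \geq 0$ (here $I$ in $I+t\phi$ is the identity map on $M_n(\mathbb{C})$ and products/inverses are with respect to composition). For $q$-positive maps $\phi,\psi$ on $M_n(\mathbb{C})$, $\phi$ $q$-dominates $\psi$ (written $\phi \geq_q \psi$, and $\psi$ is called a $q$-subordinate of $\phi$) if $\phi(I+t\phi)^{-1}-\psi(I+t\psi)^{-1}$ is completely positive for all $t \geq 0$. A $q$-positive map $\phi$ is $q$-pure if its set of $q$-subordinates is $\{\phi(I+s\phi)^{-1}\}_{s\geq 0} \cup \{0\}$. *)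

(* Defs.v *)
From HB Require Import structures.
From mathcomp Require Import all_boot all_order all_algebra.
From mathcomp Require Import complex.
From mathcomp Require Import classical_sets reals.

Set Implicit Arguments.
Unset Strict Implicit.
Unset Printing Implicit Defensive.

Import Order.TTheory GRing.Theory Num.Theory.
Local Open Scope classical_set_scope.
Local Open Scope ring_scope.
Local Open Scope complex_scope.
Local Open Scope sesquilinear_scope.

Section QPositive.
Variable R : realType.
Local Notation C := R[i].

(* In the order of R[i], 0 <= a says that a is real and nonnegative. *)
Definition positive_mx n (A : 'M[C]_n) : Prop :=
  A ^t* = A /\ forall a : C, eigenvalue A a -> 0 <= a.

Section MatrixMaps.
Variable n : nat.

(* A matrix in M_k(M_n(C)) is a square matrix of size \sum_(i < k) n, cut into
   k * k blocks of size n * n. *)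
Definition ampliation k (phi : 'End('M[C]_n))
    (A : 'M[C]_(\sum_(i < k) n)) : 'M[C]_(\sum_(i < k) n) :=
  \mxblock_(i < k, j < k) phi (submxblock A i j).

Definition completely_positive (phi : 'End('M[C]_n)) : Prop :=
  forall k (A : 'M[C]_(\sum_(i < k) n)),
    positive_mx A -> positive_mx (ampliation phi A).

(* phi (I + t phi)^-1. The library's (_)^-1%VF is total; it is the two-sided
   inverse as soon as I + t phi is bijective, which for t >= 0 holds whenever
   phi has no negative eigenvalue. *)
Definition qresolvent (phi : 'End('M[C]_n)) (t : R) : 'End('M[C]_n) :=
  (phi \o (\1 + t%:C *: phi)^-1)%VF.

(* a < 0 in R[i] says that a is real and negative. *)
Definition q_positive (phi : 'End('M[C]_n)) : Prop :=
  (forall a : C, a < 0 -> ~~ passmx.leigenvalue phi a) /\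
  (forall t : R, 0 <= t -> completely_positive (qresolvent phi t)).

Definition q_dominates (phi psi : 'End('M[C]_n)) : Prop :=
  forall t : R, 0 <= t ->
    completely_positive (qresolvent phi t - qresolvent psi t).

Definition q_subordinates (phi : 'End('M[C]_n)) : set 'End('M[C]_n) :=
  [set psi | q_positive psi /\ q_dominates phi psi].

Definition q_pure (phi : 'End('M[C]_n)) : Prop :=
  q_positive phi /\
  q_subordinates phi =
    [set qresolvent phi s | s in [set s : R | 0 <= s]] `|` [set 0].

Definition unital (phi : 'End('M[C]_n)) : Prop := phi 1%:M = 1%:M.

End MatrixMaps.
End QPositive.

(* Main.v *)
From HB Require Import structures.
Require Import Defs.
From mathcomp Require Import all_boot all_order all_algebra.
From mathcomp Require Import complex.
From mathcomp Require Import classical_sets reals.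
From mathcomp Require Import ring.
Import Order.TTheory GRing.Theory Num.Theory.

(** The argument works in every dimension. Write Q_t for phi (1 + t phi)^-1.

    From Q_t (1 + t phi) = phi one gets t Q_t (phi B) = phi B - Q_t B, while
    Q_t vanishes on ker phi. Complete positivity and unitality bound the
    entries of t Q_t uniformly in t, so t Q_t (phi B) tends to phi B at rate
    1/t. Hence ker phi meets the range of phi trivially, and t Q_t tends to the
    projection L onto the range of phi along ker phi ([range_proj_lim]). As a
    limit of 2-positive maps, L is 2-positive; it is also unital and idempotent
    ([range_proj_two_positive], [range_proj_unital], [range_projK]).

    The functional tau = tr o L is tr (T -) for a positive matrix T. Let E be
    the support projection of T and F = 1 - E. By the Cauchy-Schwarz inequality
    for 2-positive maps L, hence phi, only sees the corner E M E. The key point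
    is that every a in the range of L commutes with E. With y = E a E one has L
    y = a, so the Kadison-Schwarz inequality gives L (y* y) >= a* a, and tau
    being L-invariant, tau (y* y) >= tau (a* a) = tau (y* y) + tau (x* x) for x
    = F a E. Thus tau (x* x) = 0, which forces x to vanish on the support of T,
    that is x = 0 ([support_projection_range]).

    It follows that psi = E phi(-) E is a q-subordinate of phi: its resolvents
    are E Q_t(-) E, and since the values of Q_t commute with E the difference
    Q_t - E Q_t E is the compression F Q_t F ([corner_q_positive],
    [corner_q_dominated]). Finally psi 1 = E. A nonzero positive matrix killed
    by phi makes E different from 1, and E is nonzero because phi is; so psi is
    neither 0 nor any Q_s, since Q_s 1 = (1 + s)^-1 is an invertible scalar. *)

Local Open Scope ring_scope.
Local Open Scope sesquilinear_scope.

Set Implicit Arguments.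
Unset Strict Implicit.
Unset Printing Implicit Defensive.

(** * Adjoints, forms and positive matrices *)

Section Adjoint.
Variable C : numClosedFieldType.

Lemma adjmxM m n p (A : 'M[C]_(m, n)) (B : 'M[C]_(n, p)) :
  (A *m B)^t* = B^t* *m A^t*.
Proof. by rewrite trmx_mul map_mxM. Qed.

Lemma adjmxD m n (A B : 'M[C]_(m, n)) : (A + B)^t* = A^t* + B^t*.
Proof. by rewrite linearD map_mxD. Qed.

Lemma adjmxB m n (A B : 'M[C]_(m, n)) : (A - B)^t* = A^t* - B^t*.
Proof. by rewrite linearB map_mxB. Qed.

Lemma adjmxZ m n (a : C) (A : 'M[C]_(m, n)) : (a *: A)^t* = a^* *: A^t*.
Proof. by rewrite linearZ map_mxZ. Qed.

Lemma adjmx1 n : (1%:M : 'M[C]_n)^t* = 1%:M.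
Proof. by rewrite trmx1 map_mx1. Qed.

Lemma adjmx0 m n : (0 : 'M[C]_(m, n))^t* = 0.
Proof. by rewrite trmx0 map_mx0. Qed.

Lemma adjmx_delta m n i j : (delta_mx i j : 'M[C]_(m, n))^t* = delta_mx j i.
Proof. by rewrite trmx_delta map_delta_mx. Qed.

Lemma trace_gramE m n (x : 'M[C]_(m, n)) :
  \tr (x *m x^t*) = \sum_i \sum_j `|x i j| ^+ 2.
Proof.
apply: eq_bigr => i _; rewrite mxE; apply: eq_bigr => j _.
by rewrite !mxE normCK.
Qed.

Lemma trace_gram_ge0 m n (x : 'M[C]_(m, n)) : 0 <= \tr (x *m x^t*).
Proof.
by rewrite trace_gramE; do 2!apply: sumr_ge0 => ? _; rewrite exprn_ge0.
Qed.

Lemma trace_gram_eq0 m n (x : 'M[C]_(m, n)) : \tr (x *m x^t*) = 0 -> x = 0.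
Proof.
rewrite trace_gramE => /psumr_eq0P/= h; apply/matrixP => i j; rewrite mxE.
have /h/(_ i isT)/psumr_eq0P/= : forall i, true -> 0 <= \sum_j `|x i j| ^+ 2.
  by move=> k _; apply: sumr_ge0 => ? _; rewrite exprn_ge0.
move/(_ (fun j _ => exprn_ge0 2 (normr_ge0 _)))/(_ j isT)/eqP.
by rewrite expf_eq0 normr_eq0 /= => /eqP.
Qed.

Definition mxform n (r q : 'rV[C]_n) (M : 'M[C]_n) : C := (r *m M *m q^t*) 0 0.

(** Positivity as a condition on the quadratic form: unlike the eigenvalues,
    its values are linear in M, so it survives sums and limits. *)
Definition psdmx n (M : 'M[C]_n) := forall r, 0 <= mxform r r M.

(** Declaring linearity in the matrix argument lets the generic lemmas on
    linear maps push forms through sums, scalings and limits of matrices. *)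
Lemma mxform_is_linear n (r q : 'rV[C]_n) : scalar (mxform r q).
Proof. by move=> a M N; rewrite /mxform linearP mulmxDl -scalemxAl !mxE. Qed.

HB.instance Definition _ n (r q : 'rV[C]_n) :=
  GRing.isLinear.Build C 'M[C]_n C *%R (mxform r q) (mxform_is_linear r q).

Lemma mxformC n (M : 'M[C]_n) r q : (mxform r q M)^* = mxform q r (M^t*).
Proof.
have -> : (mxform r q M)^* = ((r *m M *m q^t*)^t* : 'M_1) 0 0.
  by rewrite [RHS]mxE [in RHS]mxE.
by rewrite !adjmxM trmxCK mulmxA.
Qed.

Lemma mxform_delta n (M : 'M[C]_n) i j :
  mxform (delta_mx 0 i) (delta_mx 0 j) M = M i j.
Proof. by rewrite /mxform adjmx_delta -rowE -colE !mxE. Qed.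

Lemma mxformZl n (M : 'M[C]_n) a r q : mxform (a *: r) q M = a * mxform r q M.
Proof. by rewrite /mxform -!scalemxAl mxE. Qed.

Lemma mxformZr n (M : 'M[C]_n) a r q : mxform r (a *: q) M = a^* * mxform r q M.
Proof. by rewrite /mxform adjmxZ -scalemxAr mxE. Qed.

Lemma mxform_gram n m (x : 'M[C]_(m, n)) r :
  mxform r r (x^t* *m x) = \tr ((r *m x^t*) *m (r *m x^t*)^t*).
Proof. by rewrite /mxform trace_mx11 adjmxM trmxCK !mulmxA. Qed.

Lemma gram_psd n m (x : 'M[C]_(m, n)) : psdmx (x^t* *m x).
Proof. by move=> r; rewrite mxform_gram trace_gram_ge0. Qed.

Lemma spectral_decomposition n (A : 'M[C]_n) : A^t* = A ->
  exists (P : 'M[C]_n) (d : 'rV[C]_n),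
  P *m P^t* = 1%:M /\ A = P^t* *m diag_mx d *m P.
Proof.
move=> hA; pose P := spectralmx A.
have uP : P \is unitarymx by exact: spectral_unitarymx.
exists P, (spectral_diag A); split; first exact/unitarymxP.
rewrite -invmx_unitary //; apply/orthomx_spectralP.
by apply/normalmxP; rewrite hA.
Qed.

(** The square root of the spectral decomposition. Gram matrices are the form
    in which positivity is used: they are stable under compression, and their
    vanishing is detected by the trace. *)
Lemma psd_gram n (A : 'M[C]_n) : A^t* = A ->
  (forall a, eigenvalue A a -> 0 <= a) -> exists x : 'M[C]_n, A = x^t* *m x.
Proof.
move=> hA eA; have [P [d [PP' defA]]] := spectral_decomposition hA.
have d_ge0 i : 0 <= d 0 i.
  apply: eA; apply/eigenvalueP; exists (row i P).
    rewrite defA -row_mul !mulmxA PP' mul1mx row_mul row_diag_mx.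
    by rewrite -scalemxAl -rowE.
  apply: contra_eq_neq PP' => Pi0; apply/eqP => /matrixP/(_ i i).
  have -> : (P *m P^t*) i i = (row i P *m P^t*) 0 i.
    by rewrite -row_mul [RHS]mxE.
  by rewrite Pi0 mul0mx !mxE eqxx => /esym/eqP; rewrite oner_eq0.
exists (diag_mx (map_mx sqrtC d) *m P); rewrite defA adjmxM.
rewrite -!mulmxA; congr (_ *m _); rewrite !mulmxA; congr (_ *m _).
rewrite tr_diag_mx map_diag_mx mulmx_diag; congr diag_mx.
apply/rowP => i; rewrite !mxE; have := sqrtC_ge0 (d 0 i); rewrite d_ge0.
move=> /ger0_real/CrealP h; rewrite -[LHS]sqrtCK expr2.
by congr (_ * _); exact/esym.
Qed.

Lemma psd_eigenvalue_ge0 n (A : 'M[C]_n) a :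
  psdmx A -> eigenvalue A a -> 0 <= a.
Proof.
move=> pA /eigenvalueP[v vA v0]; have := pA v.
rewrite /mxform vA -scalemxAl mxE -trace_mx11 pmulr_lge0 //.
rewrite lt_neqAle trace_gram_ge0 andbT.
by apply: contraNneq v0 => /esym/trace_gram_eq0/eqP.
Qed.

Lemma trace_adjmx m (A : 'M[C]_m) : \tr (A^t*) = (\tr A)^*.
Proof. by rewrite trace_map_mx mxtrace_tr. Qed.

Lemma trace_psd_conj_ge0 m n (M : 'M[C]_n) (s : 'M[C]_(m, n)) :
  psdmx M -> 0 <= \tr (s *m M *m s^t*).
Proof.
move=> pM; apply: sumr_ge0 => i _.
have := pM (row i s); congr (0 <= _).
rewrite /mxform -row_mul mxE [RHS]mxE; apply: eq_bigr => j _.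
by rewrite !mxE.
Qed.

Lemma psd_trace_eq0 n (A : 'M[C]_n) : A^t* = A -> psdmx A -> \tr A = 0 -> A = 0.
Proof.
move=> hA pA; have [x ->] := psd_gram hA (fun a => psd_eigenvalue_ge0 pA).
rewrite -{2}[x]trmxCK => /trace_gram_eq0 /(congr1 (fun M : 'M_n => M^t*)).
by rewrite trmxCK adjmx0 => ->; rewrite mulmx0.
Qed.

End Adjoint.

(** * 2-positive maps and their Schwarz inequalities *)

Section TwoPositive.
Variables (C : numClosedFieldType) (n : nat).
Implicit Types (K : 'End('M[C]_n)) (A : 'M[C]_n) (r q : 'rV[C]_n).

(** The instance of 2-positivity at the Gram matrix of the pair (x, y), tested
    against the block vector (r, q). In this form the condition is linear in K
    and closed, so it passes from resolvents to their limit. *)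
Definition two_positive K := forall m (x y : 'M[C]_(m, n)) r q,
  0 <= mxform r r (K (x^t* *m x)) + mxform r q (K (x^t* *m y))
     + mxform q r (K (y^t* *m x)) + mxform q q (K (y^t* *m y)).

Definition adjoint_preserving K := forall A, K (A^t*) = (K A)^t*.

Lemma two_positive_psd K m (x : 'M[C]_(m, n)) :
  two_positive K -> psdmx (K (x^t* *m x)).
Proof.
move=> K2 r; have := K2 _ x 0 r 0.
by rewrite adjmx0 mulmx0 !mul0mx linear0 !linear0 !addr0.
Qed.

(** Rescaling the first vector by a puts a free phase and modulus on the
    off-diagonal term, as in every proof of a Cauchy-Schwarz inequality. *)
Lemma two_positive_twist K m (x y : 'M[C]_(m, n)) r q (a : C) :
  two_positive K -> adjoint_preserving K ->
  0 <= a * a^* * mxform r r (K (x^t* *m x))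
     + a * mxform r q (K (x^t* *m y)) + (a * mxform r q (K (x^t* *m y)))^*
     + mxform q q (K (y^t* *m y)).
Proof.
move=> K2 Kadj; have := K2 _ x y (a *: r) q.
rewrite !mxformZl !mxformZr mulrA; congr (0 <= _ + _ + _ + _).
by rewrite rmorphM /= mxformC -Kadj adjmxM trmxCK.
Qed.

(** Test 2-positivity on the pair (x, 1) with second vector - r (K x)*, which
    completes the square. *)
Lemma kadison_schwarz K x : two_positive K -> adjoint_preserving K ->
  K 1%:M = 1%:M -> psdmx (K (x^t* *m x) - (K x)^t* *m K x).
Proof.
move=> K2 Kadj K1 r; have := K2 _ x 1%:M r (- (r *m (K x)^t*)).
rewrite adjmx1 !mul1mx !mulmx1 Kadj K1 linearB /=; congr (0 <= _).
rewrite /mxform raddfN /= map_mxN adjmxM trmxCK !(mulmxN, mulNmx) !mxE !mulmx1.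
by rewrite !mulmxA opprK addrAC subrK.
Qed.

(** The degenerate case of Cauchy-Schwarz: a form whose first diagonal entry is
    0 must have a zero off-diagonal entry, or a large multiple of it would make
    the form negative. *)
Lemma two_positive_kernel K m (x y : 'M[C]_(m, n)) :
  two_positive K -> adjoint_preserving K ->
  K (x^t* *m x) = 0 -> K (x^t* *m y) = 0.
Proof.
move=> K2 Kadj Kx; apply/matrixP => i j; rewrite [RHS]mxE -mxform_delta.
set r := delta_mx _ i; set q := delta_mx _ j.
have := two_positive_twist x y r q _ K2 Kadj.
rewrite Kx linear0 /=; set b := mxform r q _; set c := mxform q q _ => h.
apply/eqP; apply: contraT => b0.
have nb : 0 < `|b| ^+ 2 by rewrite exprn_gt0 // normr_gt0.
have c_ge0 : 0 <= c by exact: two_positive_psd.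
(* This scale makes the off-diagonal contribution equal to - 2 (c + 1). *)
pose s := (c + 1) / `|b| ^+ 2.
have s_real : s^* = s.
  by apply/CrealP/ger0_real; rewrite divr_ge0 ?addr_ge0 ?ler01 ?(ltW nb).
have := h (- s * b^*); rewrite mulr0 add0r.
rewrite rmorphM rmorphM rmorphN /= conjCK s_real.
have -> : - s * b^* * b + - s * b * b^* + c = - (s * `|b| ^+ 2) *+ 2 + c.
  by rewrite normCK; ring.
have -> : - (s * `|b| ^+ 2) *+ 2 + c = - (c + 2).
  by rewrite /s divfK ?gt_eqF //; ring.
by rewrite oppr_ge0 => /le_gtF; rewrite ltr_wpDl.
Qed.

(** The arithmetic-geometric form of Cauchy-Schwarz: twist by the phase that
    turns the off-diagonal entry into minus its modulus. *)
Lemma two_positive_bound K m (x y : 'M[C]_(m, n)) r q :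
  two_positive K -> adjoint_preserving K ->
  `|mxform r q (K (x^t* *m y))| *+ 2
    <= mxform r r (K (x^t* *m x)) + mxform q q (K (y^t* *m y)).
Proof.
move=> K2 Kadj; set b := mxform r q _; set p := mxform r r _.
set c := mxform q q _.
have [->|b0] := eqVneq b 0.
  by rewrite normr0 mul0rn addr_ge0 // two_positive_psd.
have nb : `|b| != 0 by rewrite normr_eq0.
have cn : (`|b|^-1)^* = `|b|^-1 by apply/CrealP; rewrite rpredV normr_real.
have := two_positive_twist x y r q (- `|b|^-1 * b^*) K2 Kadj.
rewrite -/b -/p -/c !rmorphM !rmorphN /= conjCK cn.
have -> : - `|b|^-1 * b^* * (- `|b|^-1 * b) * p + - `|b|^-1 * b^* * b +
   - `|b|^-1 * b * b^* + c
  = (`|b|^-1 ^+ 2 * (b * b^*)) * p - (`|b|^-1 * (b * b^*)) *+ 2 + c by ring.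
rewrite -normCK -exprMn mulVf // expr1n mul1r expr2 mulKf //.
by rewrite addrAC subr_ge0.
Qed.

End TwoPositive.

Local Open Scope complex_scope.

(** * Completely positive maps *)

Section CompletelyPositive.
Variables (R : realType) (n : nat).
Local Notation C := R[i].
Implicit Types (K phi : 'End('M[C]_n)).

Lemma gram_positive m k (x : 'M[C]_(k, m)) : positive_mx (x^t* *m x).
Proof.
split=> [|a]; first by rewrite adjmxM trmxCK.
exact/psd_eigenvalue_ge0/gram_psd.
Qed.

Lemma positive_gram m (A : 'M[C]_m) :
  positive_mx A -> exists x : 'M[C]_m, A = x^t* *m x.
Proof. by case; exact: psd_gram. Qed.

Lemma adjmx_mxrow k m (x : 'I_k -> 'M[C]_(m, n)) :
  (\mxrow_i x i)^t* = \mxcol_i (x i)^t*.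
Proof. by apply/matrixP => i j; rewrite !mxE. Qed.

Lemma adjmx_mxblock k (B : 'I_k -> 'I_k -> 'M[C]_n) :
  (\mxblock_(i, j) B i j)^t* = \mxblock_(i, j) (B j i)^t*.
Proof. by apply/matrixP => i j; rewrite !mxE. Qed.

Lemma gram_mxrow k m (x : 'I_k -> 'M[C]_(m, n)) :
  (\mxrow_i x i)^t* *m \mxrow_i x i = \mxblock_(i, j) ((x i)^t* *m x j).
Proof. by rewrite adjmx_mxrow mul_mxcol_mxrow. Qed.

Lemma mxform_mxblock k (r : 'I_k -> 'rV[C]_n) (B : 'I_k -> 'I_k -> 'M[C]_n) :
  mxform (\mxrow_i r i) (\mxrow_i r i) (\mxblock_(i, j) B i j)
    = \sum_j \sum_i mxform (r i) (r j) (B i j).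
Proof.
rewrite /mxform mul_mxrow_mxblock adjmx_mxrow mul_mxrow_mxcol summxE.
apply: eq_bigr => j _; rewrite mulmx_suml summxE; exact: eq_bigr.
Qed.

Lemma ampliation_gram phi k m (x : 'I_k -> 'M[C]_(m, n)) :
  ampliation phi ((\mxrow_i x i)^t* *m \mxrow_i x i)
    = \mxblock_(i, j) phi ((x i)^t* *m x j).
Proof.
apply: eq_mxblock => i j; congr (phi _).
by rewrite gram_mxrow mxblockK.
Qed.

(** Apply the ampliation to the Gram matrix of the row of blocks x i, which is
    positive by construction. *)
Lemma completely_positive_form phi k m (x : 'I_k -> 'M[C]_(m, n))
    (r : 'I_k -> 'rV_n) :
  completely_positive phi ->
  0 <= \sum_j \sum_i mxform (r i) (r j) (phi ((x i)^t* *m x j)).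
Proof.
move=> /(_ k _ (gram_positive (\mxrow_i x i)))/positive_gram[y].
by rewrite ampliation_gram -mxform_mxblock => ->; exact: gram_psd.
Qed.

Lemma completely_positive_two phi : completely_positive phi -> two_positive phi.
Proof.
move=> cp m x y r q.
have := completely_positive_form (fun i : 'I_2 => if i == 0 then x else y)
  (fun i => if i == 0 then r else q) cp.
by do 3!rewrite big_ord_recl big_ord1; rewrite /= addrACA addrA.
Qed.

(** The ampliation of the Gram matrix of (A, 1) is self-adjoint; compare its
    two off-diagonal blocks. *)
Lemma completely_positive_adjoint phi :
  completely_positive phi -> adjoint_preserving phi.
Proof.
move=> cp A; pose x := fun i : 'I_2 => if i == 0 then A else 1%:M.
have [+ _] := cp _ _ (gram_positive (\mxrow_i x i)).
rewrite ampliation_gram adjmx_mxblock => /eq_mxblockP/(_ ord0 ord_max).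
by rewrite /x /= adjmx1 mul1mx mulmx1.
Qed.

Definition compress (P : 'M[C]_n) : 'End('M[C]_n) :=
  linfun (mulmx (P^t*) \o mulmxr P).

Lemma compressE P A : compress P A = P^t* *m A *m P.
Proof. by rewrite lfunE /= mulmxA. Qed.

(** If the ampliation of phi takes A to the Gram matrix of a row of blocks y i,
    that of the compressed map takes A to the Gram matrix of the row y i P. *)
Lemma completely_positive_compress phi P :
  completely_positive phi -> completely_positive (compress P \o phi).
Proof.
move=> cp k A /(cp k)/positive_gram[y amp].
suff -> : ampliation (compress P \o phi) A
    = (\mxrow_i (submxrow y i *m P))^t* *m \mxrow_i (submxrow y i *m P).
  exact: gram_positive.
rewrite gram_mxrow; apply: eq_mxblock => i j.
rewrite comp_lfunE compressE adjmxM -!mulmxA; congr (_ *m _).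
rewrite !mulmxA; congr (_ *m _).
have -> : phi (submxblock A i j) = submxblock (ampliation phi A) i j.
  by rewrite mxblockK.
by rewrite amp -[y in LHS]submxrowK gram_mxrow mxblockK.
Qed.

End CompletelyPositive.

(** * Limits with linear rate, and resolvents *)

Section LinearRateLimit.
Variable R : realType.
Local Notation C := R[i].

(** Convergence at infinity with error O(1/t), with an explicit constant: the
    rate at which the resolvents approach the range projection. *)
Definition linear_rate_lim (f : R -> C) (l : C) :=
  exists M, forall t, 0 < t -> `|f t - l| * t%:C <= M.

Lemma bounded_multiples_eq0 (w M : C) :
  0 <= w -> (forall t : R, 0 < t -> w * t%:C <= M) -> w = 0.
Proof.
move=> w_ge0 h; apply/eqP; apply: contraT => w_neq0.
have w_gt0 : 0 < w by rewrite lt_def w_neq0.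
have M_gt0 : 0 < M.
  by apply: lt_le_trans (h 1 ltr01); rewrite mulr1.
have [w' defw] := complex_realP _ (gtr0_real w_gt0).
have [M' defM] := complex_realP _ (gtr0_real M_gt0).
move: w_gt0 M_gt0 h; rewrite defw defM !ltcR => w_gt0 M_gt0.
move=> /(_ ((M' + 1) / w')); rewrite divr_gt0 ?addr_gt0 // => /(_ isT).
rewrite -rmorphM /= lecR mulrC divfK ?gt_eqF // => /le_gtF.
by rewrite ltrDl ltr01.
Qed.

Lemma linear_rate_limD f g a b : linear_rate_lim f a -> linear_rate_lim g b ->
  linear_rate_lim (fun t => f t + g t) (a + b).
Proof.
move=> [M hM] [N hN]; exists (M + N) => t t_gt0.
apply: le_trans (lerD (hM t t_gt0) (hN t t_gt0)).
rewrite -mulrDl ler_wpM2r ?lecR ?(ltW t_gt0) //.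
by rewrite opprD addrACA ler_normD.
Qed.

Lemma linear_rate_lim_ge0 f l :
  (forall t, 0 < t -> 0 <= f t) -> linear_rate_lim f l -> 0 <= l.
Proof.
move=> f_ge0 [M hM].
(* The nonnegative f t is close to l, so its modulus f t is close to `|l|. *)
suff -> : l = `|l| by [].
apply/subr0_eq/normr0_eq0; apply: (@bounded_multiples_eq0 _ (M + M)) => //.
move=> t t_gt0.
apply: le_trans (_ : (`|f t - l| + `|f t - l|) * t%:C <= _); last first.
  by rewrite mulrDl lerD ?hM.
rewrite ler_wpM2r ?lecR ?(ltW t_gt0) //.
have -> : l - `|l| = (l - f t) + (`|f t| - `|l|).
  by rewrite (ger0_norm (f_ge0 t t_gt0)) addrA subrK.
apply: le_trans (ler_normD _ _) (lerD _ _); first by rewrite distrC.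
exact: ler_dist_dist.
Qed.

End LinearRateLimit.

Section Resolvent.
Variables (R : realType) (n : nat).
Local Notation C := R[i].
Implicit Types phi psi : 'End('M[C]_n).

Definition no_negative_eigenvalue phi :=
  forall a : C, a < 0 -> ~~ passmx.leigenvalue phi a.

Lemma no_negative_eigenvalueP phi :
  no_negative_eigenvalue phi <->
  forall (a : C) A, a < 0 -> phi A = a *: A -> A = 0.
Proof.
split=> [h a A /h + phiA | h a a_lt0].
  rewrite /passmx.leigenvalue negbK => /eqP ker0; apply/eqP.
  rewrite -memv0 -ker0 memv_ker !(add_lfunE, opp_lfunE, scale_lfunE, id_lfunE).
  by rewrite phiA subrr.
rewrite negbK; apply/eqP/vspaceP => A; rewrite memv_ker memv0.
rewrite !(add_lfunE, opp_lfunE, scale_lfunE, id_lfunE) subr_eq0.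
apply/eqP/eqP => [/h -> //|->]; by rewrite linear0 scaler0.
Qed.

(** For t > 0 a kernel vector of 1 + t phi is an eigenvector of phi whose
    eigenvalue is -1/t. *)
Lemma resolvent_injective phi t : no_negative_eigenvalue phi -> 0 <= t ->
  lker (\1 + t%:C *: phi)%VF == 0%VS.
Proof.
move=> /no_negative_eigenvalueP neg t_ge0; apply/eqP/vspaceP => A.
rewrite memv_ker memv0 !(add_lfunE, opp_lfunE, scale_lfunE, id_lfunE).
apply/eqP/eqP => [h|->]; last first.
  by rewrite linear0 scaler0 addr0.
have [t0|t0] := eqVneq t 0; first by move: h; rewrite t0 scale0r addr0.
have tC0 : t%:C != 0 by rewrite (inj_eq (@complexI R)).
apply: (neg (- t%:C^-1)).
  by rewrite oppr_lt0 invr_gt0 ltcR lt_def t0.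
apply: (scalerI tC0); rewrite scalerA mulrN divff // scaleN1r.
by apply: (addrI A); rewrite h subrr.
Qed.

Lemma qresolvent_absorb phi t A : no_negative_eigenvalue phi -> 0 <= t ->
  qresolvent phi t (A + t%:C *: phi A) = phi A.
Proof.
move=> neg t_ge0; rewrite comp_lfunE; congr (phi _).
have := lker0_lfunK (resolvent_injective neg t_ge0) A.
by rewrite !(add_lfunE, opp_lfunE, scale_lfunE, id_lfunE).
Qed.

Lemma qresolvent_unique phi psi t : no_negative_eigenvalue phi -> 0 <= t ->
  (forall A, psi (A + t%:C *: phi A) = phi A) -> qresolvent phi t = psi.
Proof.
move=> neg t_ge0 h; apply/lfunP => B.
have := lker0_lfunVK (resolvent_injective neg t_ge0) B.
rewrite !(add_lfunE, opp_lfunE, scale_lfunE, id_lfunE).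
set A := (_^-1)%VF B => defB.
by rewrite -{1}defB qresolvent_absorb // -h defB.
Qed.

Lemma qresolvent0 phi : no_negative_eigenvalue phi -> qresolvent phi 0 = phi.
Proof.
by move=> neg; apply: qresolvent_unique => // A; rewrite scale0r addr0.
Qed.

Lemma qresolvent_ker phi t A : no_negative_eigenvalue phi -> 0 <= t ->
  phi A = 0 -> qresolvent phi t A = 0.
Proof.
move=> neg t_ge0 phiA; have := qresolvent_absorb A neg t_ge0.
by rewrite phiA scaler0 addr0.
Qed.

(** The identity behind the convergence of t Q_t on the range of phi. *)
Lemma qresolvent_image phi t A : no_negative_eigenvalue phi -> 0 <= t ->
  t%:C *: qresolvent phi t (phi A) = phi A - qresolvent phi t A.
Proof.
move=> neg t_ge0; rewrite -[phi A in RHS](qresolvent_absorb A neg t_ge0).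
by rewrite linearD linearZ /= addrAC subrr add0r.
Qed.

Lemma qresolvent_unital phi t : no_negative_eigenvalue phi -> 0 <= t ->
  unital phi -> (1 + t%:C) *: qresolvent phi t 1%:M = 1%:M.
Proof.
move=> neg t_ge0 phi1; rewrite -{2}phi1 -(qresolvent_absorb 1%:M neg t_ge0).
by rewrite phi1 -linearZ scalerDl scale1r.
Qed.

End Resolvent.

(** * The projection onto the range as a limit of resolvents *)

Section RangeProjection.
Variables (R : realType) (n : nat).
Local Notation C := R[i].
Variable phi : 'End('M[C]_n).
Hypotheses (phi_unital : unital phi) (phi_qpos : q_positive phi).

Let neg : no_negative_eigenvalue phi := phi_qpos.1.

Lemma q_positive_adjoint : adjoint_preserving phi.
Proof.
by rewrite -(qresolvent0 neg); apply/completely_positive_adjoint/phi_qpos.2.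
Qed.

(** A bound for the forms of t Q_t A that does not depend on t. *)
Definition form_bound (r q : 'rV[C]_n) (A : 'M[C]_n) : C :=
  (\sum_i \sum_j `|A i j|) * (mxform r r 1%:M + mxform q q 1%:M).

(** The diagonal matrix units are positive and add up to 1, whose image under
    Q_t is the scalar 1 / (1 + t). *)
Lemma qresolvent_diag_bound t (r : 'rV[C]_n) i : 0 < t ->
  t%:C * mxform r r (qresolvent phi t (delta_mx i i)) <= mxform r r 1%:M.
Proof.
move=> t_gt0; have t_ge0 := ltW t_gt0.
have Q2 := completely_positive_two (phi_qpos.2 t t_ge0).
have diag_ge0 k : 0 <= mxform r r (qresolvent phi t (delta_mx k k)).
  have := two_positive_psd (delta_mx k k) Q2 r.
  by rewrite adjmx_delta mul_delta_mx.
have le_sum : mxform r r (qresolvent phi t (delta_mx i i))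
    <= mxform r r (qresolvent phi t 1%:M).
  rewrite mx1_sum_delta !linear_sum /= (bigD1 i) //= lerDl.
  by apply: sumr_ge0 => k _.
have t1 : t%:C <= 1 + t%:C by rewrite lerDr ler01.
apply: le_trans (_ : (1 + t%:C) * mxform r r (qresolvent phi t 1%:M) <= _).
  by apply: ler_pM => //; rewrite lecR.
by rewrite -linearZ /= qresolvent_unital.
Qed.

(** Factor the matrix unit e_ij as e_ii* e_ij and apply Cauchy-Schwarz, which
    leaves the diagonal units e_ii and e_jj. *)
Lemma qresolvent_delta_bound t (r q : 'rV[C]_n) i j : 0 < t ->
  t%:C * `|mxform r q (qresolvent phi t (delta_mx i j))|
    <= mxform r r 1%:M + mxform q q 1%:M.
Proof.
move=> t_gt0; have cp := phi_qpos.2 t (ltW t_gt0).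
have := two_positive_bound (delta_mx i i) (delta_mx i j) r q
  (completely_positive_two cp) (completely_positive_adjoint cp).
rewrite !adjmx_delta !mul_delta_mx => h.
have tC_ge0 : 0 <= t%:C by rewrite lecR ltW.
apply: le_trans (lerD (qresolvent_diag_bound r i t_gt0)
                      (qresolvent_diag_bound q j t_gt0)).
rewrite -mulrDr ler_wpM2l //; apply: le_trans h.
by rewrite -[X in X <= _]mulr1n ler_wpMn2l.
Qed.

Lemma qresolvent_bound t (r q : 'rV[C]_n) A : 0 < t ->
  `|mxform r q (qresolvent phi t A)| * t%:C <= form_bound r q A.
Proof.
move=> t_gt0; have tC_ge0 : 0 <= t%:C by rewrite lecR ltW.
rewrite {1}(matrix_sum_delta A) !linear_sum /= mulrC /form_bound mulr_suml.
apply: le_trans (ler_wpM2l tC_ge0 (ler_norm_sum _ _ _)) _.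
rewrite mulr_sumr; apply: ler_sum => i _; rewrite !linear_sum /= mulr_suml.
apply: le_trans (ler_wpM2l tC_ge0 (ler_norm_sum _ _ _)) _.
rewrite mulr_sumr; apply: ler_sum => j _; rewrite !linearZ /= normrM mulrCA.
by rewrite ler_wpM2l // qresolvent_delta_bound.
Qed.

Lemma qresolvent_image_lim (r q : 'rV[C]_n) A Z : phi Z = 0 ->
  linear_rate_lim (fun t => mxform r q (t%:C *: qresolvent phi t (phi A + Z)))
    (mxform r q (phi A)).
Proof.
move=> phiZ; exists (form_bound r q A) => t t_gt0; have t_ge0 := ltW t_gt0.
rewrite linearD /= (qresolvent_ker neg t_ge0 phiZ) addr0.
rewrite qresolvent_image // linearB /= addrAC subrr add0r normrN.
exact: qresolvent_bound.
Qed.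

(** If phi A is killed by phi then Q_t (phi A) = 0, so phi A = Q_t A has size
    O(1/t) for every t. *)
Lemma q_positive_range_ker : (limg phi :&: lker phi = 0)%VS.
Proof.
apply/eqP; rewrite -subv0; apply/subvP => B; rewrite memv_cap memv_ker memv0.
move=> /andP[/memv_imgP[A _ ->] /eqP phi2A]; apply/eqP/matrixP => i j.
rewrite [RHS]mxE -mxform_delta; apply/normr0_eq0.
set r := delta_mx _ i; set q := delta_mx _ j.
apply: (bounded_multiples_eq0 (M := form_bound r q A)) => // t t_gt0.
have := qresolvent_image A neg (ltW t_gt0).
rewrite (qresolvent_ker neg (ltW t_gt0) phi2A) scaler0.
by move=> /esym/subr0_eq ->; exact: qresolvent_bound.
Qed.

Definition range_proj : 'End('M[C]_n) := daddv_pi (limg phi) (lker phi).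
Local Notation L := range_proj.

Lemma range_proj_image A : L (phi A) = phi A.
Proof. by rewrite daddv_pi_id ?q_positive_range_ker // memv_img ?memvf. Qed.

(** Rank-nullity turns the trivial intersection into a direct sum. *)
Lemma range_decomposition A : exists B Z, phi Z = 0 /\ A = phi B + Z.
Proof.
have full : (limg phi + lker phi)%VS = fullv.
  apply/eqP; rewrite eqEdim subvf dimv_disjoint_sum ?q_positive_range_ker //=.
  by rewrite addnC -(limg_ker_dim phi fullv) capfv.
have /memv_addP[_ /memv_imgP[B _ ->] [Z kerZ defA]] :
  A \in (limg phi + lker phi)%VS by rewrite full memvf.
by exists B, Z; split=> //; apply/eqP; rewrite -memv_ker.
Qed.

Lemma range_proj_ker Z : phi Z = 0 -> L Z = 0.
Proof.
move=> phiZ; have kr : (lker phi :&: limg phi = 0)%VS.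
  by rewrite capvC q_positive_range_ker.
have kZ : Z \in lker phi by rewrite memv_ker phiZ.
have := daddv_pi_add q_positive_range_ker (subvP (addvSr (limg phi) _) _ kZ).
by rewrite (daddv_pi_id kr kZ) -[X in _ = X]add0r => /addIr.
Qed.

Lemma range_projE B Z : phi Z = 0 -> L (phi B + Z) = phi B.
Proof.
by move=> phiZ; rewrite linearD /= range_proj_image range_proj_ker // addr0.
Qed.

Lemma range_proj_lim (r q : 'rV[C]_n) A :
  linear_rate_lim (fun t => mxform r q (t%:C *: qresolvent phi t A))
    (mxform r q (L A)).
Proof.
have [B [Z [phiZ ->]]] := range_decomposition A.
rewrite range_projE //; exact: qresolvent_image_lim.
Qed.

(** Each of the four terms is a limit of the corresponding term of t Q_t. *)
Lemma range_proj_two_positive : two_positive L.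
Proof.
move=> m x y r q; apply: linear_rate_lim_ge0 (linear_rate_limD
  (linear_rate_limD (linear_rate_limD
    (range_proj_lim r r (x^t* *m x)) (range_proj_lim r q (x^t* *m y)))
    (range_proj_lim q r (y^t* *m x))) (range_proj_lim q q (y^t* *m y))).
move=> t t_gt0; rewrite !linearZ /= -!mulrDr mulr_ge0 ?lecR ?(ltW t_gt0) //.
exact/completely_positive_two/phi_qpos.2/ltW.
Qed.

Lemma range_proj_adjoint : adjoint_preserving L.
Proof.
move=> A; have [B [Z [phiZ ->]]] := range_decomposition A.
have phiZ' : phi (Z^t*) = 0 by rewrite q_positive_adjoint phiZ adjmx0.
by rewrite adjmxD -q_positive_adjoint !range_projE // q_positive_adjoint.
Qed.

Lemma range_proj_unital : unital L.
Proof. by rewrite /unital -{1}phi_unital range_proj_image. Qed.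

Lemma range_projK A : L (L A) = L A.
Proof.
by rewrite {1}/range_proj daddv_pi_id ?memv_pi //; exact: q_positive_range_ker.
Qed.

Lemma range_proj_absorb A : phi (L A) = phi A.
Proof.
have [B [Z [phiZ ->]]] := range_decomposition A.
by rewrite range_projE // linearD /= phiZ addr0.
Qed.

End RangeProjection.

(** * The support of the trace functional *)

Section Support.
Variables (R : realType) (n : nat).
Local Notation C := R[i].

Variable L : 'End('M[C]_n).
Hypotheses (L2 : two_positive L) (L_adj : adjoint_preserving L).
Hypotheses (L_unital : unital L) (L_idem : forall A, L (L A) = L A).

(** The density matrix of the functional tr o L. *)
Definition trace_density : 'M[C]_n := \matrix_(i, j) \tr (L (delta_mx j i)).
Local Notation T := trace_density.

Lemma trace_densityE A : \tr (T *m A) = \tr (L A).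
Proof.
rewrite {2}(matrix_sum_delta A) !linear_sum /=.
under [RHS]eq_bigr do rewrite !linear_sum /=.
rewrite [RHS]exchange_big /=; apply: eq_bigr => j _; rewrite mxE.
by apply: eq_bigr => i _; rewrite !linearZ /= mxE mulrC.
Qed.

(** T is positive because r T r* is the trace of L (r* r). *)
Lemma trace_density_gram : exists s : 'M[C]_n, T = s^t* *m s.
Proof.
have hT : T^t* = T.
  apply/matrixP => i j; rewrite mxE [T^T _ _]mxE [LHS]/= !mxE.
  by rewrite -trace_adjmx -L_adj adjmx_delta.
apply: psd_gram hT _ => a; apply: psd_eigenvalue_ge0 => r.
rewrite /mxform -trace_mx11 mxtrace_mulC mulmxA mxtrace_mulC trace_densityE.
rewrite -[L _]mul1mx -[1%:M *m _]mulmx1 -{2}adjmx1.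
exact/trace_psd_conj_ge0/two_positive_psd.
Qed.

Lemma trace_density_ge0 M : psdmx M -> 0 <= \tr (L M).
Proof.
have [s defT] := trace_density_gram => pM.
by rewrite -trace_densityE defT -mulmxA mxtrace_mulC trace_psd_conj_ge0.
Qed.

(** For T = s* s the trace is the squared Hilbert-Schmidt norm of s x*. *)
Lemma trace_density_ker m (x : 'M[C]_(m, n)) :
  \tr (L (x^t* *m x)) = 0 -> x *m T = 0.
Proof.
have [s defT] := trace_density_gram; rewrite -trace_densityE defT.
rewrite -mulmxA mxtrace_mulC.
have -> : s *m (x^t* *m x) *m s^t* = (s *m x^t*) *m (s *m x^t*)^t*.
  by rewrite adjmxM trmxCK !mulmxA.
move=> /trace_gram_eq0/(congr1 (fun M : 'M_(n, m) => M^t*)).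
by rewrite adjmxM trmxCK adjmx0 mulmxA => ->; rewrite mul0mx.
Qed.

(** In an eigenbasis of T, replace the nonzero eigenvalues by 1. *)
Lemma support_projection : exists E : 'M[C]_n,
  [/\ E^t* = E, E *m E = E, T *m (1%:M - E) = 0
    & forall m (x : 'M[C]_(m, n)), x *m T = 0 -> x *m E = 0].
Proof.
have hT : T^t* = T by have [s ->] := trace_density_gram; rewrite adjmxM trmxCK.
have [P [d [PP' defT]]] := spectral_decomposition hT.
pose e : 'rV[C]_n := \row_i (d 0 i != 0)%:R.
have ee : diag_mx e *m diag_mx e = diag_mx e.
  rewrite mulmx_diag; congr diag_mx; apply/rowP => i; rewrite !mxE.
  by case: (d 0 i != 0); rewrite ?mulr1 ?mulr0.
have de : diag_mx d *m diag_mx e = diag_mx d.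
  rewrite mulmx_diag; congr diag_mx; apply/rowP => i; rewrite !mxE.
  by case: eqVneq => [->|]; rewrite ?mulr1 ?mulr0.
have conjM (A B : 'M[C]_n) :
    P^t* *m A *m P *m (P^t* *m B *m P) = P^t* *m (A *m B) *m P.
  by rewrite !mulmxA -(mulmxA (P^t* *m A)) PP' mulmx1.
exists (P^t* *m diag_mx e *m P); split.
- rewrite !adjmxM trmxCK mulmxA tr_diag_mx map_diag_mx.
  congr (_ *m diag_mx _ *m _).
  by apply/rowP => i; rewrite !mxE rmorph_nat.
- by rewrite conjM ee.
- by rewrite mulmxBr mulmx1 {2}defT conjM de -defT subrr.
move=> m x; rewrite defT !mulmxA => xT.
have xd : x *m P^t* *m diag_mx d = 0.
  by rewrite -[LHS]mulmx1 -PP' mulmxA xT mul0mx.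
suff -> : x *m P^t* *m diag_mx e = 0 by rewrite mul0mx.
apply/matrixP => i j; move/matrixP/(_ i j): xd; rewrite !mul_mx_diag !mxE.
case: eqVneq => [_|d0]; first by rewrite mulr0.
by move/eqP; rewrite mulf_eq0 (negPf d0) orbF => /eqP ->; rewrite mul0r.
Qed.

(** The heart of the proof: off-diagonal corners x = F a E of a fixed point a
    of L have tr L (x* x) <= 0, by comparing the Kadison-Schwarz inequality at
    E a E with the decomposition of E a* a E along 1 = E + F. *)
Lemma support_projection_range (E : 'M[C]_n) :
  E^t* = E -> E *m E = E -> T *m (1%:M - E) = 0 ->
  (forall m (x : 'M[C]_(m, n)), x *m T = 0 -> x *m E = 0) ->
  (forall M, L (E *m M *m E) = L M) /\
  (forall a, L a = a -> E *m a = a *m E).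
Proof.
move=> E_adj E_idem TF T_ker; pose F := 1%:M - E.
have F_adj : F^t* = F by rewrite adjmxB adjmx1 E_adj.
have F_idem : F *m F = F.
  by rewrite mulmxBr mulmx1 mulmxBl mul1mx E_idem subrr subr0.
have LF : L F = 0.
  apply: psd_trace_eq0; first by rewrite -L_adj F_adj.
    by rewrite -[F]F_idem -{1}F_adj; exact: two_positive_psd.
  by rewrite -trace_densityE TF mxtrace0.
have LFM M : L (F *m M) = 0.
  by rewrite -F_adj two_positive_kernel // F_adj F_idem.
have LMF M : L (M *m F) = 0.
  by rewrite -[M *m F]trmxCK L_adj adjmxM F_adj LFM adjmx0.
have LEM M : L (E *m M) = L M.
  apply/esym/subr0_eq; rewrite -linearB /= -{1}[M]mul1mx -mulmxBl; exact: LFM.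
have LE M : L (E *m M *m E) = L M.
  rewrite -mulmxA LEM; apply/esym/subr0_eq.
  rewrite -linearB /= -{1}[M]mulmx1 -mulmxBr; exact: LMF.
have FaE a : L a = a -> F *m a *m E = 0.
  move=> La; pose y := E *m a *m E; pose x := F *m a *m E.
  have Ly : L y = a by rewrite LE.
  have gram Q : Q^t* = Q -> Q *m Q = Q ->
      (Q *m a *m E)^t* *m (Q *m a *m E) = E *m a^t* *m (Q *m (a *m E)).
    by move=> Qh QQ; rewrite !adjmxM E_adj Qh -!mulmxA (mulmxA Q Q) QQ.
  have aa : E *m (a^t* *m a) *m E = y^t* *m y + x^t* *m x.
    rewrite /y /x !gram // -mulmxDr -mulmxDl addrC subrK mul1mx.
    by rewrite !mulmxA.
  (* As L is idempotent, L (L (y* y) - a* a) = L (y* y - a* a), whose trace is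
     minus that of L (x* x). *)
  have := trace_density_ge0 (kadison_schwarz y L2 L_adj L_unital).
  rewrite linearB /= L_idem Ly -(LE (a^t* *m a)) aa (linearD L) /= opprD addrA.
  rewrite subrr add0r raddfN oppr_ge0 => x_le0.
  have x_ge0 : 0 <= \tr (L (x^t* *m x)) by exact/trace_density_ge0/gram_psd.
  have /T_ker : x *m T = 0 by apply/trace_density_ker/le_anti/andP.
  by rewrite /x -mulmxA E_idem.
have EaE a : L a = a -> a *m E = E *m a *m E.
  move=> /FaE/eqP; rewrite mulmxBl mul1mx mulmxBl subr_eq0 => /eqP; exact.
(* The other corner E a F is the adjoint of the corner F a* E of a*. *)
split=> // a La; have := EaE (a^t*); rewrite L_adj La => /(_ erefl).
move/(congr1 (fun M : 'M_n => M^t*)).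
by rewrite !adjmxM E_adj trmxCK mulmxA => ->; rewrite EaE.
Qed.

End Support.

(** * The corner of phi as a q-subordinate *)

Section Subordinate.
Variables (R : realType) (n : nat).
Local Notation C := R[i].
Variable phi : 'End('M[C]_n).
Variable E : 'M[C]_n.
Hypotheses (phi_qpos : q_positive phi) (E_adj : E^t* = E) (E_idem : E *m E = E).
Hypothesis phiE : forall A, phi (E *m A *m E) = phi A.
Hypothesis E_comm : forall A, E *m phi A = phi A *m E.

Local Notation psi := (compress E \o phi)%VF.

Let neg : no_negative_eigenvalue phi := phi_qpos.1.

Let psiE A : psi A = E *m phi A *m E.
Proof. by rewrite comp_lfunE compressE E_adj. Qed.

(** Since phi does not see the compression, phi maps eigenvectors of psi with a
    nonzero eigenvalue to eigenvectors of phi with the same eigenvalue. *)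
Lemma corner_no_negative_eigenvalue : no_negative_eigenvalue psi.
Proof.
apply/no_negative_eigenvalueP => a A a_lt0 psiA.
have phi2 : phi (phi A) = a *: phi A by rewrite -phiE -psiE psiA linearZ.
have phiA := (no_negative_eigenvalueP phi).1 neg a _ a_lt0 phi2.
move/esym/eqP: psiA; rewrite psiE phiA mulmx0 mul0mx scaler_eq0.
by rewrite (lt_eqF a_lt0) => /eqP.
Qed.

Lemma corner_qresolvent t : 0 <= t ->
  qresolvent psi t = (compress E \o qresolvent phi t)%VF.
Proof.
move=> t_ge0.
apply: (qresolvent_unique corner_no_negative_eigenvalue t_ge0) => A.
have QE B : qresolvent phi t (E *m B *m E) = qresolvent phi t B.
  apply/subr0_eq; rewrite -linearB; apply: qresolvent_ker => //.
  by rewrite linearB /= phiE subrr.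
rewrite [psi A in RHS]comp_lfunE [LHS]comp_lfunE; congr (compress E _).
by rewrite psiE linearD linearZ /= QE -linearZ -linearD /= qresolvent_absorb.
Qed.

Lemma corner_q_positive : q_positive psi.
Proof.
split=> [|t t_ge0]; first exact: corner_no_negative_eigenvalue.
rewrite (corner_qresolvent t_ge0).
exact: completely_positive_compress (phi_qpos.2 t t_ge0).
Qed.

(** The values of Q_t commute with E, so they have no off-diagonal corners, and
    removing the E corner leaves a compression by 1 - E. *)
Lemma corner_q_dominated : q_dominates phi psi.
Proof.
move=> t t_ge0; rewrite (corner_qresolvent t_ge0).
suff -> : (qresolvent phi t - (compress E \o qresolvent phi t)
    = compress (1%:M - E) \o qresolvent phi t)%VF.
  exact: completely_positive_compress (phi_qpos.2 t t_ge0).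
have Q_comm A : E *m qresolvent phi t A = qresolvent phi t A *m E.
  by rewrite [qresolvent phi t A]comp_lfunE; exact: E_comm.
move: (qresolvent phi t) Q_comm => Q Q_comm; apply/lfunP => A.
rewrite add_lfunE opp_lfunE !comp_lfunE !compressE E_adj adjmxB adjmx1 E_adj.
by rewrite !mulmxBr !mulmxBl !mulmx1 !mul1mx Q_comm -mulmxA E_idem subrr subr0.
Qed.

End Subordinate.

Lemma positive_kernel_not_q_pure (R : realType) (n : nat)
    (phi : 'End('M[R[i]]_n)) :
  unital phi -> q_positive phi ->
  (exists A : 'M[R[i]]_n, [/\ A != 0, positive_mx A & phi A = 0]) ->
  ~ q_pure phi.
Proof.
move=> phi1 qp [A [A_neq0 A_pos phiA]] [_ pure].
pose L := range_proj phi.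
have L2 := range_proj_two_positive phi1 qp.
have L_adj := range_proj_adjoint phi1 qp.
have L1 := range_proj_unital phi1 qp.
have L_idem := range_projK phi1 qp.
have [E [E_adj E_idem TF T_ker]] := support_projection L2 L_adj.
have [LE E_comm] :=
  support_projection_range L2 L_adj L1 L_idem E_adj E_idem TF T_ker.
have phiE B : phi (E *m B *m E) = phi B.
  by rewrite -(range_proj_absorb phi1 qp) LE range_proj_absorb.
have phi_comm B : E *m phi B = phi B *m E.
  by apply: E_comm; rewrite (range_proj_image phi1 qp).
(* For a Gram matrix A = x* x killed by phi, x annihilates the support of T. *)
have E_neq1 : E <> 1%:M.
  have [x defA] := positive_gram A_pos.
  have /T_ker xE : x *m trace_density L = 0.
    apply: (trace_density_ker L2 L_adj).
    by rewrite -defA (range_proj_ker phi1 qp) // mxtrace0.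
  by move=> E1; case/eqP: A_neq0; rewrite defA -[x]mulmx1 -E1 xE mulmx0.
have : q_subordinates phi (compress E \o phi)%VF.
  split; first exact: corner_q_positive.
  exact: corner_q_dominated.
have psi1 : (compress E \o phi)%VF 1%:M = E.
  by rewrite comp_lfunE compressE phi1 mulmx1 E_adj.
(* If psi = 0 then E = 0, so phi = 0; if psi = Q_s then the projection E is an
   invertible scalar. *)
rewrite pure => -[[s s_ge0 psi_s]|psi_0]; apply: E_neq1; last first.
  have E0 : E = 0 by rewrite -psi1 psi_0 zero_lfunE.
  by rewrite E0 -phi1 -phiE E0 mulmx0 linear0.
have := qresolvent_unital qp.1 s_ge0 phi1; rewrite psi_s psi1 => sE.
by rewrite -[LHS]mul1mx -sE -scalemxAl E_idem.
Qed.

Theorem proposition4p5 (R : realType) (phi : 'End('M[R[i]]_3)) :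
  unital phi -> q_positive phi ->
  (exists A : 'M[R[i]]_3, [/\ A != 0, positive_mx A & phi A = 0]) ->
  ~ q_pure phi.
Proof. exact: positive_kernel_not_q_pure. Qed.
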